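(* Let $\sigma\in\mathbb{R}$ with $\sigma\ge 1$, and let $\beta_\sigma$ be the symmetric fractional B-spline of order $\sigma$. Then $G(z):=\sum_{n\in\mathbb{Z}}\beta_\sigma(n)\,z^{-n}$ has no roots on the unit circle $|z|=1$, i.e. $G(z)\neq 0$ for every $z\in\mathbb{C}$ with $|z|=1$.
   Context: The Fourier transform convention is $\widehat{f}(\omega)=\int_{\mathbb{R}}f(t)e^{-i\omega t}\,dt$. For real $\sigma>-1$ the symmetric fractional B-spline $\beta_\sigma\in L^1(\mathbb{R})\cap L^2(\mathbb{R})$ is defined by its Fourier transform $$\widehat{\beta}_\sigma(\omega)=\left|\frac{\sin(\omega/2)}{\omega/2}\right|^{\sigma+1}$$ (with value $1$ at $\omega=0$). For $\sigma\ge 1$, $\widehat\beta_\sigma$ is integrable and $\beta_\sigma$ denotes the continuous function $\beta_\sigma(t)=\frac{1}{2\pi}\int_{\mathbb{R}}\widehat{\beta}_\sigma(\omega)e^{i\omega t}\,d\omega$, so that the values $\beta_\sigma(n)$ make sense. *)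

(* Defs.v *)
From HB Require Import structures.
From mathcomp Require Import all_boot all_order all_algebra.
From mathcomp Require Import all_classical all_reals all_analysis.
From mathcomp Require Import complex.
From mathcomp.analysis Require showcase.summability.

Set Implicit Arguments.
Unset Strict Implicit.
Unset Printing Implicit Defensive.

Import Order.TTheory GRing.Theory Num.Theory.
Import numFieldNormedType.Exports.

Local Open Scope classical_set_scope.
Local Open Scope ring_scope.
Local Open Scope complex_scope.

Definition expi (R : realType) (x : R) : R[i] := cos x +i* sin x.

Definition Cintegral (R : realType) (f : R -> R[i]) : R[i] :=
  (\int[lebesgue_measure]_(x in [set: R]) complex.Re (f x)) +i*
  (\int[lebesgue_measure]_(x in [set: R]) complex.Im (f x)).

Definition bspline_hat (R : realType) (sigma w : R) : R :=
  if w == 0 then 1 else `|sin (w / 2) / (w / 2)| `^ (sigma + 1).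

(* Inverse Fourier transform of bspline_hat; this is the B-spline itself
   whenever bspline_hat sigma is integrable, in particular for 1 <= sigma. *)
Definition bspline (R : realType) (sigma t : R) : R[i] :=
  ((2 * pi)^-1)%:C * Cintegral (fun w => (bspline_hat sigma w)%:C * expi (w * t)).

Definition G_term (R : realType) (sigma : R) (z : R[i]) (n : int) : R[i]^o :=
  bspline sigma n%:~R * z ^ (- n).

(* Convergence of the series over int is unconditional: the limit of the finite
   partial sums along the finite subsets of int ordered by inclusion. The alias
   R[i]^o gives R[i] the topology of its modulus. *)
Definition G_converges (R : realType) (sigma : R) (z : R[i]) : Prop :=
  cvg (summability.partial_sum (G_term sigma z) @ summability.totally).

Definition G (R : realType) (sigma : R) (z : R[i]) : R[i]^o :=
  summability.sum (G_term sigma z).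

(* Main.v *)
Require Import Defs.
From HB Require Import structures.
From mathcomp Require Import all_boot all_order all_algebra.
From mathcomp Require Import all_classical all_reals all_analysis.
From mathcomp Require Import complex finmap measurable_realfun ring lra.
From mathcomp.analysis Require showcase.summability.

(** Write f for the Fourier transform of the B-spline, so f(w) = |sinc(w/2)|^(sigma+1),
    where the exponent is at least 2.

    Convergence: the function |u|^p with p >= 2 has a second-order Taylor estimate at
    every point of [-1,1], and sinc has first and second differences of size |h|/(1+|w|)
    and h^2/(1+|w|); hence f has second differences of size h^2/(1+w^2). Shifting the
    integration variable by h = pi/n changes the sign of exp(i w n), so that 4 beta(n)
    is controlled by the integral of the second difference of f with this step, which
    gives beta(n) = O(1/n^2).

    Non-vanishing: for z = exp(i x) with |x| <= pi, the N-th Cesaro mean of the symmetric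
    partial sums of G(z) is the integral of f(w) against the Fejer kernel
    |sum_(j<N) exp(i j (w - x))|^2 / N, up to the factor 1/(2 pi). This kernel is
    nonnegative everywhere and at least N/4 for |w - x| <= 1/N, while f is bounded below
    on [-pi,pi]. The means therefore have real part at least a positive constant
    independent of N, and so does their limit G(z). *)

Set Implicit Arguments.
Unset Strict Implicit.
Unset Printing Implicit Defensive.

Import Order.TTheory GRing.Theory Num.Theory.
Import numFieldNormedType.Exports.
Import summability.

Local Open Scope classical_set_scope.
Local Open Scope ring_scope.

#[local] Existing Instance totally_filter.

(** * Second-order estimate for real powers *)

Ltac nonneg := repeat first [assumption | exact: sqr_ge0 | exact: powR_ge0
  | exact: normr_ge0 | by lra | apply: mulr_ge0 | apply: addr_ge0].

Section elementary.
Context {R : realType}.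
Implicit Types (p t x h a b : R).

(** Bernoulli's inequality: Young's inequality for the product t * 1 with the conjugate exponents p
    and p / (p - 1), multiplied by p. *)
Lemma powR_ge_tangent p t : 1 < p -> 0 <= t -> 1 + p * (t - 1) <= t `^ p.
Proof.
move=> p1 t0; have p0 : 0 < p by lra.
have q0 : 0 < p / (p - 1) by rewrite divr_gt0 // subr_gt0.
have := @conjugate_powR R t 1 p (p / (p - 1)) t0 ler01 p0 q0.
rewrite powR1 mulr1 => /(_ _)/wrap[]; first by field; rewrite !gt_eqF //; lra.
move=> H; have : p * t <= p * (t `^ p / p + 1 / (p / (p - 1))).
  by rewrite ler_pM2l.
have -> : p * (t `^ p / p + 1 / (p / (p - 1))) = t `^ p + (p - 1).
  by field; rewrite !gt_eqF //; lra.
lra.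
Qed.

(** Bernoulli's inequality makes the remainder nonnegative, so only an upper bound is left. The two
    summands of the constant serve the cases (p - 1)(t - 1) <= 1/2 and > 1/2. *)
Lemma powR_tangent_quadratic p : 1 < p -> exists2 C : R, 0 <= C &
  forall t, 0 <= t <= 2 -> `|t `^ p - 1 - p * (t - 1)| <= C * (t - 1) ^+ 2.
Proof.
move=> p1; exists (2 * p * (p - 1) + 2 `^ p * (4 * (p - 1) ^+ 2)).
  by nonneg.
move=> t /andP[t0 t2]; have L := powR_ge_tangent p1 t0.
rewrite ger0_norm; last by lra.
have A0 : 0 <= 2 `^ p * (4 * (p - 1) ^+ 2) * (t - 1) ^+ 2.
  by nonneg.
have B0 : 0 <= 2 * p * (p - 1) * (t - 1) ^+ 2.
  by nonneg.
rewrite mulrDl.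
have [small|big] := lerP ((p - 1) * (t - 1)) (1 / 2); last first.
  (* Here t is so far from 1 that the quadratic term with factor 2^p already exceeds t^p. *)
  have H1 : 1 <= 4 * (p - 1) ^+ 2 * (t - 1) ^+ 2.
    rewrite -mulrA -exprMn; move: big; set y := (p - 1) * (t - 1) => big; nra.
  have t1 : 1 < t by rewrite -subr_gt0; nra.
  have : t `^ p <= 2 `^ p by rewrite ge0_ler_powR // ?nnegrE; lra.
  have : 2 `^ p <= 2 `^ p * (4 * (p - 1) ^+ 2) * (t - 1) ^+ 2.
    by rewrite -mulrA ler_peMr ?powR_ge0.
  have : 0 <= p * (t - 1) by rewrite mulr_ge0; lra.
  lra.
have [->|tn0] := eqVneq t 0.
  have : 0 <= 2 `^ p * (4 * (p - 1) ^+ 2) by nonneg.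
  rewrite powR0 ?gt_eqF //; [nra|lra].
have tp : 0 < t by rewrite lt_neqAle eq_sym tn0.
(* The upper bound is the tangent inequality at 1/t. *)
have tv0 : 0 <= t^-1 by rewrite invr_ge0.
have tpp : 0 < t `^ p by rewrite powR_gt0.
have K' : (1 + p * (t^-1 - 1)) * t `^ p <= 1.
  apply: (@le_trans _ _ (t^-1 `^ p * t `^ p)); last first.
    by rewrite -powRM // mulVf // powR1.
  by rewrite ler_pM2r //; exact: powR_ge_tangent.
have K2 : (t - p * (t - 1)) * t `^ p <= t.
  have -> : t - p * (t - 1) = t * (1 + p * (t^-1 - 1)) by field.
  by rewrite -mulrA ler_piMr // ltW.
(* By [K2], since t - p (t - 1) = 1 - (p - 1)(t - 1). In this case that factor is at least 1/2;
   dividing by it gives the constant 2 p (p - 1). *)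
have : (1 - (p - 1) * (t - 1)) * (t `^ p - 1 - p * (t - 1)) <=
   p * (p - 1) * (t - 1) ^+ 2 by nra.
nra.
Qed.

Lemma normpowR_le_sqr p a : 2 <= p -> `|a| <= 1 -> `|a| `^ p <= a ^+ 2.
Proof.
move=> p2 a1; have [->|a0] := eqVneq a 0.
  by rewrite normr0 powR0 ?expr0n ?gt_eqF //; lra.
rewrite -[leRHS]real_normK ?num_real // -powR_mulrn ?normr_ge0 //.
by apply: ger_powR => //; rewrite normr_gt0 a0.
Qed.

(** By homogeneity: writing b = a t with a nonzero pulls out |a|^p <= a^2 and reduces the estimate
    to the expansion of |t|^p at t = 1. *)
Lemma normpowR_taylor p : 2 <= p -> exists (C : R) (D : R -> R),
  [/\ 0 <= C, forall a, `|a| <= 1 -> `|D a| <= C * `|a| &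
   forall a b, `|a| <= 1 -> `|b| <= 1 ->
   `| `|b| `^ p - `|a| `^ p - D a * (b - a)| <= C * (b - a) ^+ 2].
Proof.
move=> p2; have p1 : 1 < p by lra.
have [C C0 HC] := powR_tangent_quadratic p1.
(* At a = 0 the quotient is 0, which is the derivative there. *)
exists (C + p + 5), (fun a => p * (`|a| `^ p / a)); split; first by lra.
  move=> a a1; have [->|a0] := eqVneq a 0; first by rewrite invr0 !mulr0 normr0 mulr0.
  rewrite !normrM normfV ger0_norm; last lra.
  rewrite (ger0_norm (powR_ge0 _ _)).
  have n0 : 0 < `|a| by rewrite normr_gt0.
  have : `|a| `^ p / `|a| <= `|a|.
    by rewrite ler_pdivrMr // (le_trans (normpowR_le_sqr p2 a1)) // -expr2 real_normK ?num_real.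
  nra.
move=> a b a1 b1.
have fa := normpowR_le_sqr p2 a1; have fb := normpowR_le_sqr p2 b1.
have [a0|a0] := eqVneq a 0.
  rewrite a0 invr0 !mulr0 mul0r normr0 powR0 ?gt_eqF ?subr0 //; last lra.
  rewrite ger0_norm ?powR_ge0 //; have := sqr_ge0 b; nra.
have [t bE] : exists t, b = a * t by exists (b / a); field.
subst b.
have -> : `|a * t| `^ p - `|a| `^ p - p * (`|a| `^ p / a) * (a * t - a) =
   `|a| `^ p * (`|t| `^ p - 1 - p * (t - 1)).
  by rewrite normrM powRM ?normr_ge0 //; field.
rewrite normrM (ger0_norm (powR_ge0 _ _)).
have -> : (a * t - a) ^+ 2 = a ^+ 2 * (t - 1) ^+ 2 by ring.
have s0 := sqr_ge0 (t - 1); have s1 := sqr_ge0 a; have s2 := powR_ge0 `|a| p.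
have [tin|tout] := boolP (0 <= t <= 2).
  have t0 : 0 <= t by case/andP: tin.
  have := HC t tin; rewrite {1}(ger0_norm t0) => H.
  have s3 := normr_ge0 (t `^ p - 1 - p * (t - 1)).
  apply: (@le_trans _ _ (a ^+ 2 * (C * (t - 1) ^+ 2))); first exact: ler_pM.
  have : 0 <= a ^+ 2 * (t - 1) ^+ 2 by rewrite mulr_ge0.
  nra.
(* Outside [0, 2] the terms of order zero and one are absorbed by (t - 1)^2; they account for the
   summand p + 5 = 4 + (1 + p) of the constant. *)
have d1 : 1 <= `|t - 1|.
  move: tout; rewrite negb_and -!ltNge => /orP[H|H].
    by rewrite ltr0_norm; lra.
  by rewrite gtr0_norm; lra.
have n2 : `|t - 1| ^+ 2 = (t - 1) ^+ 2 by rewrite real_normK ?num_real.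
have tt : t ^+ 2 <= 4 * (t - 1) ^+ 2.
  have := ler_normD (t - 1) 1; rewrite subrK normr1 => H.
  rewrite -[t ^+ 2]real_normK ?num_real //; have := normr_ge0 t; nra.
have K : `|a| `^ p * `| `|t| `^ p - 1 - p * (t - 1)| <=
    `|a| `^ p * `|t| `^ p + `|a| `^ p * (1 + p * `|t - 1|).
  rewrite -mulrDr ler_wpM2l // (le_trans (ler_normB _ _)) //.
  rewrite (normrM p) (ger0_norm (_ : 0 <= p)); last lra.
  have := ler_normB (`|t| `^ p) 1.
  rewrite normr1 (ger0_norm (powR_ge0 _ _)); lra.
apply: (le_trans K).
rewrite -powRM ?normr_ge0 // -normrM.
have : `|a| `^ p * (1 + p * `|t - 1|) <= a ^+ 2 * (1 + p * `|t - 1|).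
  by rewrite ler_wpM2r //; nra.
have : a ^+ 2 * (1 + p * `|t - 1|) <= a ^+ 2 * ((1 + p) * (t - 1) ^+ 2).
  rewrite ler_wpM2l // -n2; have : `|t - 1| <= `|t - 1| ^+ 2 by nra.
  by nra.
have : a ^+ 2 * t ^+ 2 <= a ^+ 2 * (4 * (t - 1) ^+ 2) by rewrite ler_wpM2l.
have : 0 <= C * (a ^+ 2 * (t - 1) ^+ 2) by nonneg.
rewrite exprMn in fb. lra.
Qed.

End elementary.

(** * Differences of the cardinal sine *)

Section sinc.
Context {R : realType}.
Implicit Types (p t x h a b : R).

Definition sinc x : R := if x == 0 then 1 else sin x / x.

Lemma mulr_sinc x : x * sinc x = sin x.
Proof.
rewrite /sinc; have [->|x0] := eqVneq x 0; first by rewrite mul0r sin0.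
by rewrite mulrC divfK.
Qed.

(* Bounds on linear combinations of cosines thus integrate to bounds on the same
   combinations of values of sinc, with no case analysis at 0. *)
Lemma is_derive_mulr_sinc a t :
  is_derive t 1 (fun s => s * sinc (s * a)) (cos (t * a)).
Proof.
rewrite /sinc; have [->|a0] := eqVneq a 0.
  rewrite mulr0 cos0; under eq_fun do rewrite mulr0 eqxx mulr1.
  exact: is_derive_id.
have -> : (fun s => s * (if s * a == 0 then 1 else sin (s * a) / (s * a))) =
    a^-1 \*: (sin \o ( *%R^~ a)).
  apply/funext => s /=; rewrite mulf_eq0 (negbTE a0) orbF.
  have [->|s0] := eqVneq s 0; first by rewrite !mul0r sin0 scaler0.
  by rewrite /GRing.scale /=; field; rewrite a0 s0.
have Dl : is_derive t 1 ( *%R^~ a) a.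
  have := is_deriveZ a (is_derive_id t 1).
  rewrite [a *: _]mulr1; congr is_derive; apply/funext => s /=.
  by rewrite /GRing.scale /= mulrC.
have := is_deriveZ a^-1 (@is_derive1_comp R sin ( *%R^~ a) t _ _ (is_derive_sin (t * a)) Dl).
by move/is_derive_eq; apply; rewrite /GRing.scale /=; field.
Qed.

(** The mean value theorem on [0, 1]. It is applied to combinations of s * sinc (s * a), whose value
    at s = 1 is the combination of sinc to be bounded. *)
Lemma norm_le_of_derive (g dg : R -> R) (M : R) :
  (forall t, is_derive t 1 g (dg t)) -> g 0 = 0 ->
  (forall t, 0 <= t <= 1 -> `|dg t| <= M) -> `|g 1| <= M.
Proof.
move=> Dg g0 HM.
have [|c cin] := @MVT_segment R g dg 0 1 ler01 (fun x _ => Dg x).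
  apply: continuous_subspaceT => x; apply/differentiable_continuous/derivable1_diffP.
  by have [] := Dg x.
by rewrite g0 !subr0 mulr1 => ->; apply: HM; move: cin; rewrite in_itv.
Qed.

Lemma norm_sinc_le1 x : `|sinc x| <= 1.
Proof.
have := norm_le_of_derive (is_derive_mulr_sinc x) (mul0r _) (fun t _ => cos_max _).
by rewrite !mul1r.
Qed.

Lemma norm_sin_le x : `|sin x| <= `|x|.
Proof. by rewrite -mulr_sinc normrM ler_piMr // norm_sinc_le1. Qed.

Lemma onem_cosE x : 1 - cos x = 2 * sin (x / 2) ^+ 2.
Proof.
have -> : cos x = cos (x / 2 + x / 2) by rewrite -splitr.
by rewrite cosD; have := cos2Dsin2 (x / 2); lra.
Qed.

Lemma onem_cos_le x : 0 <= 1 - cos x <= x ^+ 2 / 2.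
Proof.
rewrite onem_cosE; apply/andP; split; first by nonneg.
have := norm_sin_le (x / 2); rewrite -ler_sqr ?nnegrE ?normr_ge0 //.
by rewrite !real_normK ?num_real // exprMn; lra.
Qed.

Lemma cos_lipschitz a b : `|cos a - cos b| <= `|a - b|.
Proof.
have [u [v [-> ->]]] : exists u v, a = u + v /\ b = u - v.
  by exists ((a + b) / 2), ((a - b) / 2); split; lra.
rewrite cosD cosB [X in `|X| <= _](_ : _ = - 2 * sin u * sin v); last by ring.
have -> : u + v - (u - v) = 2 * v by ring.
rewrite !normrM normrN (gtr0_norm (ltr0n _ 2)) -mulrA ler_pM2l //.
rewrite (le_trans _ (norm_sin_le v)) // ler_piMl // ; exact: sin_max.
Qed.

Lemma sin_lipschitz a b : `|sin a - sin b| <= `|a - b|.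
Proof.
have := cos_lipschitz (pi / 2 - a) (pi / 2 - b).
rewrite !cosB cos_pihalf sin_pihalf !mul0r !add0r !mul1r.
by rewrite (_ : pi / 2 - a - (pi / 2 - b) = b - a) ?(distrC b) //; ring.
Qed.

Lemma sinc_lipschitz x h : `|sinc (x + h) - sinc x| <= `|h|.
Proof.
have := @norm_le_of_derive _ _ `|h|
  (fun t => is_deriveB (is_derive_mulr_sinc (x + h) t) (is_derive_mulr_sinc x t)).
rewrite !fctE /= !mul0r subr0 => /(_ erefl); rewrite !mul1r; apply => t /andP[t0 t1].
rewrite (le_trans (cos_lipschitz _ _)) // -mulrBr addrAC subrr add0r normrM.
by rewrite ler_piMl // ger0_norm.
Qed.

(** The second difference of cos (t x) with step t h is -2 cos (t x) (1 - cos (t h)), of size at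
    most h^2 for t in [0, 1]. *)
Lemma sinc_second_difference x h :
  `|sinc (x + h) - 2 * sinc x + sinc (x - h)| <= h ^+ 2.
Proof.
pose S a := fun t : R => t * sinc (t * a).
have D t : is_derive t 1 (S (x + h) - 2 \*: S x + S (x - h))
    (cos (t * (x + h)) - 2 *: cos (t * x) + cos (t * (x - h))).
  apply: is_deriveD; last exact: is_derive_mulr_sinc.
  apply: is_deriveB; first exact: is_derive_mulr_sinc.
  by apply: is_deriveZ; exact: is_derive_mulr_sinc.
have := @norm_le_of_derive _ _ (h ^+ 2) D.
rewrite !fctE /S /= !mul0r scaler0 subr0 addr0 !mul1r => /(_ erefl).
apply => t /andP[t0 t1].
rewrite mulrDr mulrBr cosD cosB /GRing.scale /=.
rewrite [X in `|X| <= _](_ : _ = - 2 * cos (t * x) * (1 - cos (t * h))); last by ring.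
have /andP[c0 c1] := onem_cos_le (t * h).
have : (t * h) ^+ 2 <= h ^+ 2.
  by rewrite exprMn ler_piMl ?sqr_ge0 // expr_le1.
rewrite !normrM normrN (gtr0_norm (ltr0n _ 2)) (ger0_norm c0).
have := cos_max (t * x); have := normr_ge0 (cos (t * x)); nra.
Qed.

Lemma sinc_decay x : (1 + `|x|) * `|sinc x| <= 2.
Proof.
have := sin_max x; rewrite -mulr_sinc normrM; have := norm_sinc_le1 x; lra.
Qed.

(** Multiplication by x turns sinc into sin up to the error h sinc (x + h), which gives 2 |h|; the
    unweighted Lipschitz bound adds the third |h|. *)
Lemma sinc_difference_decay x h :
  (1 + `|x|) * `|sinc (x + h) - sinc x| <= 3 * `|h|.
Proof.
have H : x * (sinc (x + h) - sinc x) = sin (x + h) - sin x - h * sinc (x + h).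
  rewrite -!mulr_sinc; ring.
have : `|x| * `|sinc (x + h) - sinc x| <= 2 * `|h|.
  rewrite -normrM H (le_trans (ler_normB _ _)) // normrM.
  have := sin_lipschitz (x + h) x; rewrite addrAC subrr add0r.
  have := norm_sinc_le1 (x + h); have := normr_ge0 h; nra.
have := sinc_lipschitz x h; lra.
Qed.

(** Again by multiplication by x: the second difference of sin gives h^2, the error term gives 2 h^2
    by the Lipschitz bound with step 2 h, and the unweighted bound gives the last h^2. *)
Lemma sinc_second_difference_decay x h :
  (1 + `|x|) * `|sinc (x + h) - 2 * sinc x + sinc (x - h)| <= 4 * h ^+ 2.
Proof.
have H : x * (sinc (x + h) - 2 * sinc x + sinc (x - h)) =
    - 2 * sin x * (1 - cos h) - h * (sinc (x + h) - sinc (x - h)).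
  have : - 2 * sin x * (1 - cos h) = sin (x + h) - 2 * sin x + sin (x - h).
    by rewrite sinD sinB; ring.
  by move=> ->; rewrite -!mulr_sinc; ring.
have : `|x| * `|sinc (x + h) - 2 * sinc x + sinc (x - h)| <= 3 * h ^+ 2.
  rewrite -normrM H (le_trans (ler_normB _ _)) // !normrM normrN.
  have /andP[c0 c1] := onem_cos_le h.
  rewrite (gtr0_norm (ltr0n _ 2)) (ger0_norm c0).
  have := sinc_lipschitz (x - h) (h + h); rewrite addrA subrK => L.
  have : `|h| * `|sinc (x + h) - sinc (x - h)| <= `|h| * (2 * `|h|).
    by rewrite ler_wpM2l // (le_trans L) // (le_trans (ler_normD _ _)) //; lra.
  have : `|h| ^+ 2 = h ^+ 2 by rewrite real_normK ?num_real.
  have := sin_max x; have := normr_ge0 (sin x); nra.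
have := sinc_second_difference x h; lra.
Qed.

Lemma continuous_sinc : continuous sinc.
Proof.
move=> x; apply/cvgrPdist_le => e e0; near=> y.
have := sinc_lipschitz y (x - y); rewrite (addrC y) subrK => /le_trans; apply.
by near: y; apply: cvgr_dist_le => //; exact: cvg_id.
Unshelve. all: by end_near. Qed.

(** With y = x / 2, the mean value theorem gives sin y >= y cos y, and cos x >= 0 gives cos^2 y >=
    1/2. Hence sin x = 2 sin y cos y >= 2 y cos^2 y >= x / 2. *)
Lemma sinc_ge_half x : 0 <= x <= pi / 2 -> 1 / 2 <= sinc x.
Proof.
move=> /andP[x0 xpi]; rewrite /sinc; case: eqVneq => [_|xn0]; first lra.
have xgt0 : 0 < x by rewrite lt_neqAle eq_sym xn0.
rewrite ler_pdivlMr // -[in sin x](_ : x / 2 + x / 2 = x); last by lra.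
set y := x / 2; have xE : x = y + y by rewrite /y; lra.
have cosy : y * cos y <= sin y.
  have y0 : 0 <= y by rewrite /y; lra.
  have [|c] := @MVT_segment R sin cos 0 y y0 (fun x _ => is_derive_sin x).
    by apply: continuous_subspaceT; exact: continuous_sin.
  rewrite in_itv /= sin0 !subr0 => /andP[c0 cy] ->; rewrite mulrC ler_wpM2r //.
  by rewrite leNgt ltr_cos ?in_itv /= -?leNgt //; apply/andP; split; lra.
have cy0 : 0 <= cos y by rewrite cos_ge0_pihalf // /y; apply/andP; split; lra.
have cx0 : 0 <= cos (y + y) by rewrite -xE cos_ge0_pihalf //; apply/andP; split; lra.
have cy2 : 1 / 2 <= cos y ^+ 2.
  by move: cx0; rewrite cosD -!expr2 sin2cos2; lra.
rewrite sinD xE.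
have : y * cos y * cos y <= sin y * cos y by rewrite ler_wpM2r.
have : y * (1 / 2) <= y * cos y ^+ 2 by rewrite ler_wpM2l // /y; lra.
rewrite expr2; lra.
Qed.

(** Both neighbours are expanded at sinc x, so that the linear terms combine into [D u] times the
    second difference of sinc. Each resulting term decays like (1 + |x|)^-2: the squared first
    differences do, and so does the product, since |D u| <= C |u|. *)
Lemma powR_sinc_second_difference p : 2 <= p -> exists2 C : R, 0 <= C &
  forall x h, `| `|sinc (x + h)| `^ p - 2 * `|sinc x| `^ p + `|sinc (x - h)| `^ p| <=
    C * h ^+ 2 / (1 + x ^+ 2).
Proof.
move=> p2; have [C [D [C0 HD HC]]] := normpowR_taylor p2.
(* 26 = 9 + 9 + 8: two squared first differences and the linear term. *)
exists (26 * C); first lra.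
move=> x h.
have x2 : 0 < 1 + x ^+ 2 by have := sqr_ge0 x; lra.
rewrite ler_pdivlMr //.
set u := sinc x; set v := sinc (x + h); set w := sinc (x - h).
have Hv := HC u v (norm_sinc_le1 _) (norm_sinc_le1 _).
have Hw := HC u w (norm_sinc_le1 _) (norm_sinc_le1 _).
have Hu := HD u (norm_sinc_le1 _).
have du := sinc_decay x; rewrite -/u in du.
have dv := sinc_difference_decay x h; rewrite -/u -/v in dv.
have dw := sinc_difference_decay x (- h); rewrite -/u -/w normrN in dw.
have d2 := sinc_second_difference_decay x h; rewrite -/u -/w -/v in d2.
set m := 1 + `|x|.
have m1 : 1 <= m by rewrite /m; have := normr_ge0 x; lra.
have xm : 1 + x ^+ 2 <= m ^+ 2.
  rewrite /m -[x ^+ 2]real_normK ?num_real //; have := normr_ge0 x; nra.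
apply: (@le_trans _ _ (`| `|v| `^ p - 2 * `|u| `^ p + `|w| `^ p| * m ^+ 2)).
  by rewrite ler_wpM2l.
have E : `|v| `^ p - 2 * `|u| `^ p + `|w| `^ p =
  (`|v| `^ p - `|u| `^ p - D u * (v - u)) + (`|w| `^ p - `|u| `^ p - D u * (w - u))
  + D u * (v - 2 * u + w) by ring.
rewrite E; set a1 := `|v| `^ p - `|u| `^ p - D u * (v - u) in Hv *.
set a2 := `|w| `^ p - `|u| `^ p - D u * (w - u) in Hw *.
have sqle a b : 0 <= a -> `|b| * m <= a -> b ^+ 2 * m ^+ 2 <= a ^+ 2.
  move=> a0 ba; rewrite -exprMn -[leLHS]real_normK ?num_real //.
  rewrite normrM (ger0_norm (_ : 0 <= m)); last lra.
  by rewrite ler_sqr ?nnegrE //; nonneg; lra.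
have h3 : 0 <= 3 * `|h| by rewrite mulr_ge0.
have Sv : (v - u) ^+ 2 * m ^+ 2 <= 9 * h ^+ 2.
  by rewrite (le_trans (sqle _ _ h3 _)) ?exprMn ?real_normK ?num_real // ; [rewrite mulrC|lra].
have Sw : (w - u) ^+ 2 * m ^+ 2 <= 9 * h ^+ 2.
  by rewrite (le_trans (sqle _ _ h3 _)) ?exprMn ?real_normK ?num_real // ; [rewrite mulrC|lra].
have T1 : `|a1| * m ^+ 2 <= C * (9 * h ^+ 2).
  by rewrite (le_trans (ler_wpM2r (sqr_ge0 _) Hv)) // -mulrA ler_wpM2l.
have T2 : `|a2| * m ^+ 2 <= C * (9 * h ^+ 2).
  by rewrite (le_trans (ler_wpM2r (sqr_ge0 _) Hw)) // -mulrA ler_wpM2l.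
have T3 : `|D u * (v - 2 * u + w)| * m ^+ 2 <= (C * 2) * (4 * h ^+ 2).
  rewrite normrM expr2 mulrACA; apply: ler_pM; nonneg; last by rewrite mulrC.
  rewrite (le_trans (ler_wpM2r _ Hu)) -?mulrA ?ler_wpM2l //; first lra.
  by rewrite mulrC.
have := ler_normD (a1 + a2) (D u * (v - 2 * u + w)).
have := ler_normD a1 a2; have := sqr_ge0 m; nra.
Qed.

Lemma powR_sinc_decay p x : 2 <= p -> `|sinc x| `^ p <= 4 / (1 + x ^+ 2).
Proof.
move=> p2; have x2 : 0 < 1 + x ^+ 2 by have := sqr_ge0 x; lra.
have N := normpowR_le_sqr p2 (norm_sinc_le1 x).
rewrite ler_pdivlMr // (le_trans (ler_wpM2r (ltW x2) N)) //.
have := sinc_decay x.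
rewrite -[sinc x ^+ 2]real_normK ?num_real // -[x ^+ 2]real_normK ?num_real //.
have := normr_ge0 x; have := normr_ge0 (sinc x).
move: `|x| `|sinc x| => a b b0 a0 H.
have : ((1 + a) * b) ^+ 2 <= 2 ^+ 2 by rewrite ler_sqr ?nnegrE //; nonneg.
have : 0 <= a * b ^+ 2 by nonneg.
nra.
Qed.

End sinc.

(** * Integrals over the real line *)

Section integrals.
Context {R : realType}.
Local Notation mu := (@lebesgue_measure R).
Local Notation integrable f := (mu.-integrable [set: R] (EFin \o f)).
Implicit Types (f e : R -> R) (h x : R).

Lemma measurable_addr h : measurable_fun [set: R] (fun x => x + h).
Proof. by apply: measurable_funD => //; exact: measurable_id. Qed.

(** Lebesgue measure is determined by its values on half-open intervals, which translation
    preserves. *)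
Lemma lebesgue_measure_shift h (A : set R) : measurable A ->
  pushforward mu ((fun x => x + h) : _ -> measurableTypeR R) A = mu A.
Proof.
move=> mA; apply/esym/lebesgue_measure_unique => //=; first exact: measurable_addr.
move=> _ _ [[a b]] _ <-.
rewrite /pushforward /=.
have -> : (fun x => x + h) @^-1` `]a, b]%classic = `]a - h, b - h]%classic.
  by apply/seteqP; split => x /=; rewrite !in_itv /= ltrBlDr lerBrDr.
rewrite !lebesgue_measure_itv /= !lte_fin ltrD2r.
by case: ifP => // _; rewrite -!EFinB; congr EFin; ring.
Qed.

(** The nonnegative case comes first: it yields the integrability of translates on which
    [Rintegral_shift] relies. *)
Lemma ge0_integral_shift (g : R -> \bar R) h : measurable_fun [set: R] g ->
  (forall x, 0 <= g x)%E ->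
  (\int[mu]_x g (x + h)%R = \int[mu]_x g x)%E.
Proof.
move=> mg g0; rewrite -[LHS](@ge0_integral_pushforward _ _ (measurableTypeR R) (measurableTypeR R)
  _ _ (measurable_addr h) mu setT g) //.
apply: eq_measure_integral => //=; first exact: measurable_addr.
by move=> _ A mA _; exact: lebesgue_measure_shift.
Qed.

Lemma integrable_shift f h : integrable f -> integrable (fun x => f (x + h)).
Proof.
move=> /integrableP[mf fy]; apply/integrableP; split.
  apply: (measurableT_comp mf); exact: measurable_addr.
have -> // : (\int[mu]_x `|(f (x + h)%R)%:E| = \int[mu]_x `|(EFin \o f) x|)%E.
apply: (@ge0_integral_shift (fun x => `|(EFin \o f) x|)%E) => //.
by apply: measurableT_comp.
Qed.

Lemma Rintegral_shift f h : integrable f ->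
  \int[mu]_x f (x + h) = \int[mu]_x f x.
Proof.
move=> fi; rewrite /Rintegral; congr fine.
have mf : measurable_fun setT (EFin \o f) by case/integrableP: fi.
rewrite -[LHS](@integral_pushforward _ _ (measurableTypeR R) (measurableTypeR R)
  _ _ (measurable_addr h) mu setT (EFin \o f)) //.
  apply: eq_measure_integral => //=; first exact: measurable_addr.
  by move=> _ A mA _; exact: lebesgue_measure_shift.
exact: integrable_shift.
Qed.

Lemma integrable_oneDsqrV : integrable (fun x => (1 + x ^+ 2)^-1).
Proof.
have cD : continuous (fun x : R => (1 + x ^+ 2)^-1) by exact: continuous_oneDsqrV.
apply/integrableP; split.
  by apply/measurable_EFinP; exact: continuous_measurable_fun.
under eq_integral do rewrite /= ger0_norm ?(invr_ge0, addr_ge0, sqr_ge0)//.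
rewrite ge0_symfun_integralT //; first last.
- by move=> x /=; rewrite sqrrN.
- by move=> x; rewrite ?(invr_ge0, addr_ge0, sqr_ge0).
have -> : [set x : R | 0 <= x] = `[0, +oo[%classic.
  by apply/seteqP; split => x /=; rewrite in_itv /= andbT.
by rewrite integral0y_oneDsqr -EFinM ltry.
Qed.

Lemma integrable_dominated f K : measurable_fun [set: R] f ->
  (forall x, `|f x| <= K / (1 + x ^+ 2)) -> integrable f.
Proof.
move=> mf fK; have := @integrableZl _ _ _ mu _ measurableT K _ integrable_oneDsqrV.
apply: le_integrable => //; first exact/measurable_EFinP.
by move=> x _ /=; rewrite lee_fin (le_trans (fK x)) // ler_norm.
Qed.

Lemma norm_Rintegral_dominated f K : measurable_fun [set: R] f ->
  (forall x, `|f x| <= K / (1 + x ^+ 2)) ->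
  `|\int[mu]_x f x| <= K * \int[mu]_x (1 + x ^+ 2)^-1.
Proof.
move=> mf fK; have fi := integrable_dominated mf fK.
rewrite (le_trans (le_normr_Rintegral _ fi)) // -RintegralZl //;
  last exact: integrable_oneDsqrV.
apply: le_Rintegral => //.
- exact: integrable_norm fi.
- exact: integrableZl integrable_oneDsqrV.
Qed.

Lemma integrableM_bounded f e : integrable f -> measurable_fun [set: R] e ->
  (forall x, `|e x| <= 1) -> integrable (fun x => f x * e x).
Proof.
move=> fi me e1; apply: (le_integrable _ _ _ fi) => //.
  apply/measurable_EFinP; apply: measurable_funM => //.
  by apply/measurable_EFinP; case/integrableP: fi.
by move=> x _ /=; rewrite lee_fin normrM ler_piMr.
Qed.

(** Translation by h or -h moves onto [e] as a change of sign. The second difference of [f]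
    therefore integrates against [e] to -(1 + 2 + 1) times the original integral. *)
Lemma Rintegral_antiperiodic f e h K : integrable f ->
  (forall x, `|f (x + h) - 2 * f x + f (x - h)| <= K / (1 + x ^+ 2)) ->
  measurable_fun [set: R] e -> (forall x, `|e x| <= 1) ->
  alternating e h ->
  `|\int[mu]_x (f x * e x)| <= K * \int[mu]_x (1 + x ^+ 2)^-1 / 4.
Proof.
move=> fi fK me e1 eh.
have ehN x : e (x - h) = - e x by rewrite -[in RHS](subrK h x) eh opprK.
have fei := integrableM_bounded fi me e1.
have I1 := integrableM_bounded (integrable_shift h fi) me e1.
have I2 := integrableM_bounded (integrable_shift (- h) fi) me e1.
have E1 : \int[mu]_x (f (x + h) * e x) = - \int[mu]_x (f x * e x).
  rewrite -(Rintegral_shift h fei) -[RHS]mulN1r -RintegralZl //;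
    last exact: integrable_shift fei.
  by apply: eq_Rintegral => x _; rewrite eh; ring.
have E2 : \int[mu]_x (f (x - h) * e x) = - \int[mu]_x (f x * e x).
  rewrite -(Rintegral_shift (- h) fei) -[RHS]mulN1r -RintegralZl //;
    last exact: integrable_shift fei.
  by apply: eq_Rintegral => x _; rewrite ehN; ring.
have E : \int[mu]_x ((f (x + h) - 2 * f x + f (x - h)) * e x) = - 4 * \int[mu]_x (f x * e x).
  transitivity (\int[mu]_x (f (x + h) * e x + - 2 * (f x * e x) + f (x - h) * e x)).
    by apply: eq_Rintegral => x _; ring.
  rewrite RintegralD //; last first.
    exact: (integrableD measurableT I1 (integrableZl measurableT (- 2) fei)).
  rewrite RintegralD //; last exact: integrableZl fei.
  by rewrite E1 E2 RintegralZl //; ring.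
have mf : measurable_fun setT f by apply/measurable_EFinP; case/integrableP: fi.
have := @norm_Rintegral_dominated (fun x => (f (x + h) - 2 * f x + f (x - h)) * e x) K.
rewrite E normrM normrN (gtr0_norm (ltr0n _ 4)) => H.
rewrite ler_pdivlMr // mulrC; apply: H.
  apply: measurable_funM => //; apply: measurable_funD.
    apply: measurable_funB; first exact: measurableT_comp mf (measurable_addr h).
    exact: measurable_funM.
  exact: measurableT_comp mf (measurable_addr (- h)).
by move=> x; rewrite normrM (le_trans _ (fK x)) // ler_piMr.
Qed.

End integrals.

(** * Unconditional sums *)

Section unconditional_sums.
Context {R : realType}.

Lemma partial_sumE (I : choiceType) (V : zmodType) (a : I -> V) (A : {fset I}) :
  partial_sum a A = \sum_(i <- A) a i.
Proof. by rewrite /partial_sum -(big_seq_fsetE _ _ xpredT). Qed.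

Lemma le_partial_sum (I : choiceType) (a : I -> R) (A B : {fset I}) :
  (forall i, 0 <= a i) -> (A `<=` B)%fset -> partial_sum a A <= partial_sum a B.
Proof.
move=> a0 AB; rewrite !partial_sumE.
have -> : \sum_(i <- A) a i = \sum_(i <- B) (if i \in A then a i else 0).
  rewrite -(big_fset_incl _ AB) => [|i _ /negbTE ->//].
  by apply: eq_big_seq => i ->.
by apply: ler_sum => i _; case: ifP.
Qed.

(** The partial sums increase along inclusion, so they converge to their supremum. *)
Lemma is_cvg_partial_sum_ge0 (I : choiceType) (a : I -> R) (M : R) :
  (forall i, 0 <= a i) -> (forall A, partial_sum a A <= M) ->
  cvg (partial_sum a @ totally).
Proof.
move=> a0 aM; pose E := range (partial_sum a).
have supE : has_sup E.
  split; first by exists (partial_sum a fset0), fset0.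
  by exists M => _ [A _ <-].
apply/cvg_ex; exists (sup E); apply/cvgrPdist_lt => e e0.
have [_ [A _ <-] HA] := sup_adherent e0 supE.
exists A => // B /= AB.
have : partial_sum a B <= sup E by apply: (sup_upper_bound supE); exists B.
have := le_partial_sum a0 AB; move=> h1 h2; rewrite ger0_norm; lra.
Qed.

(** The family is the difference of the nonnegative families |a| + a and |a|, both with bounded
    partial sums. *)
Lemma is_cvg_partial_sum_abs (I : choiceType) (a : I -> R) (M : R) :
  (forall A, partial_sum (fun i => `|a i|) A <= M) ->
  cvg (partial_sum a @ totally).
Proof.
move=> aM.
have c1 := is_cvg_partial_sum_ge0 (fun i => normr_ge0 (a i)) aM.
have c2 : cvg (partial_sum (fun i => `|a i| + a i) @ totally).
  apply: (@is_cvg_partial_sum_ge0 _ _ (M + M)).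
    by move=> i; have := ler_norm (- a i); rewrite normrN; lra.
  move=> A; apply: le_trans (lerD (aM A) (aM A)).
  rewrite !partial_sumE -big_split /=; apply: ler_sum => i _.
  by rewrite lerD2l ler_norm.
have -> : partial_sum a = partial_sum (fun i => `|a i| + a i) - partial_sum (fun i => `|a i|).
  apply/funext => A; rewrite !fctE !partial_sumE -sumrB.
  by apply: eq_bigr => i _; ring.
exact: is_cvgB.
Qed.

Lemma cvg_partial_sum_complex (I : choiceType) (u : I -> R[i]^o) (x y : R) :
  partial_sum (fun i => complex.Re (u i : R[i])) @ totally --> x ->
  partial_sum (fun i => complex.Im (u i : R[i])) @ totally --> y ->
  partial_sum u @ totally --> ((x +i* y)%C : R[i]^o).
Proof.
move=> cx cy; apply/cvgrPdist_lt => e e0.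
(* The radius [e] lives in R[i], where being positive means being real and positive. *)
have [r r0 re] : exists2 r : R, 0 < r & (r%:C)%C <= e.
  move: e0; rewrite ltcE /= => /andP[/eqP e1 e2]; exists (complex.Re e) => //.
  by rewrite lecE /= e1 eqxx lexx.
have r2 : 0 < r / 2 by rewrite divr_gt0.
move/cvgrPdist_lt : cx => /(_ _ r2) [A _ HA].
move/cvgrPdist_lt : cy => /(_ _ r2) [B _ HB].
exists (A `|` B)%fset => // C /=; rewrite fsubUset => /andP[AC BC].
apply: lt_le_trans re.
have {}HA := HA _ AC; have {}HB := HB _ BC.
have -> : (x +i* y)%C - partial_sum u C =
  ((x - partial_sum (fun i => complex.Re (u i : R[i])) C)
   +i* (y - partial_sum (fun i => complex.Im (u i : R[i])) C))%C.
  rewrite !partial_sumE.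
  rewrite -(raddf_sum (@complex.Re R)) -(raddf_sum (@complex.Im R)).
  by case: (\sum_(i <- C) u i).
move: HA HB; set p := x - _; set q := y - _ => HA HB.
rewrite normc_def /= ltcR.
apply: (@le_lt_trans _ _ (`|p| + `|q|)); last lra.
rewrite -[leRHS]ger0_norm ?addr_ge0 // -sqrtr_sqr ler_wsqrtr //.
rewrite -[p ^+ 2]real_normK ?num_real // -[q ^+ 2]real_normK ?num_real //.
have := normr_ge0 p; have := normr_ge0 q; nra.
Qed.

End unconditional_sums.

(** * Sums over the integers, symmetric partial sums and Cesaro means *)

Section integer_sums.
Context {R : realType}.
Implicit Types (a t : int -> R) (K : R).

(** The integer interval [-m, m]; [Negz k] stands for -(k + 1), so each step adjoins both new
    endpoints. *)
Fixpoint symmetric_range (m : nat) : {fset int} :=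
  if m is k.+1 then (Posz k.+1 |` (Negz k |` symmetric_range k))%fset else [fset Posz 0]%fset.

Lemma mem_symmetric_range m (n : int) : (n \in symmetric_range m) = (`|n| <= m)%N.
Proof.
elim: m => [|m IH] /=; first by rewrite in_fset1 leqn0 absz_eq0.
rewrite !in_fset1U IH [in RHS]leq_eqVlt ltnS orbA; congr (_ || _).
by case: n {IH} => n /=; rewrite ?orbF.
Qed.

Lemma symmetric_sumS a m : \sum_(n <- symmetric_range m.+1) a n =
  a (Posz m.+1) + (a (Negz m) + \sum_(n <- symmetric_range m) a n).
Proof.
rewrite /= big_fsetU1 ?big_fsetU1 //= ?in_fset1U ?mem_symmetric_range /= ?ltnn //.
Qed.

Lemma fsubset_symmetric_range (A : {fset int}) :
  (A `<=` symmetric_range (\max_(n <- A) `|n|%N))%fset.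
Proof.
apply/fsubsetP => n nA; rewrite mem_symmetric_range.
exact: (@leq_bigmax_seq _ (enum_fset A) xpredT absz n).
Qed.

(** Every finite set of integers lies in a symmetric interval, so an unconditional sum is also the
    limit of its symmetric partial sums. *)
Lemma symmetric_range_cvg : symmetric_range @ \oo --> @totally int.
Proof.
move=> P [A _ AP]; exists (\max_(n <- A) `|n|%N)%N => // m /= Nm.
apply: AP => /=; apply/fsubsetP => n /(fsubsetP (fsubset_symmetric_range A)).
by rewrite !mem_symmetric_range => /leq_trans; apply.
Qed.

Lemma partial_sum_square_decay a K : 0 <= K ->
  (forall n, n != 0 -> `|a n| <= K / n%:~R ^+ 2) ->
  forall A, partial_sum (fun n => `|a n|) A <= `|a 0| + 4 * K.
Proof.
move=> K0 aK A; have := fsubset_symmetric_range A; move: (\max_(n <- A) _)%N => N AN.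
apply: (le_trans (le_partial_sum (fun n => normr_ge0 (a n)) AN)).
rewrite partial_sumE.
(* Strengthened for the induction: 1/(m+1)^2 <= 2 (1/(m+1) - 1/(m+2)) telescopes, and the two signs
   of n double it to 4 K. *)
apply: (@le_trans _ _ (`|a 0| + 4 * K * (1 - (N.+1)%:R^-1))); last first.
  have : 0 <= (N.+1%:R : R)^-1 by [].
  by move: (_^-1) => x x0; have := mulr_ge0 K0 x0; lra.
elim: N {AN} => [|m IH]; first by rewrite /= big_seq_fset1 invr1 subrr mulr0 addr0.
rewrite symmetric_sumS.
have B1 := aK (Posz m.+1) isT; have B2 := aK (Negz m) isT.
have E1 : ((Posz m.+1)%:~R : R) ^+ 2 = m.+1%:R ^+ 2 by [].
have E2 : ((Negz m)%:~R : R) ^+ 2 = m.+1%:R ^+ 2 by rewrite NegzE mulrNz sqrrN.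
rewrite E1 in B1; rewrite E2 in B2.
suff : K / m.+1%:R ^+ 2 <= 2 * K * (m.+1%:R^-1 - m.+2%:R^-1).
  move: B1 B2 IH; move: (K / _) (m.+1%:R^-1) (m.+2%:R^-1) => d x y.
  by move: (\sum_(_ <- _) _) => s; lra.
have -> : 2 * K * (m.+1%:R^-1 - m.+2%:R^-1) = K * (2 / (m.+1%:R * m.+2%:R)) :> R.
  by rewrite -(natr1 m.+1); field; rewrite -?natr1 !gt_eqF.
rewrite ler_wpM2l // ler_pdivlMr ?mulr_gt0 ?ltr0n // mulrC.
rewrite -ler_pdivlMr ?invr_gt0 ?exprn_gt0 // invrK.
have : (1 : R) <= m.+1%:R by rewrite ler1n.
rewrite -(natr1 m.+1); nra.
Qed.

(** Pairs are grouped by their maximum m: the row and the column that meet at (m, m) realise each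
    difference in [-m, m] exactly once. *)
Lemma double_sum_symmetric t (N : nat) :
  \sum_(j < N) \sum_(k < N) t (Posz j - Posz k) =
  \sum_(m < N) \sum_(n <- symmetric_range m) t n.
Proof.
have S m : \sum_(n <- symmetric_range m) t n =
    \sum_(j < m.+1) t (Posz m - Posz j) + \sum_(j < m) t (Posz j - Posz m).
  elim: m => [|m IH]; first by rewrite /= big_seq_fset1 big_ord_recl !big_ord0 !addr0.
  rewrite symmetric_sumS IH [in RHS]big_ord_recl /= subr0.
  (* The split-off terms j = 0 are the new endpoints m + 1 and -(m + 1); reindexing the others by
     one returns the sums for m. *)
  rewrite [in RHS](big_ord_recl m (fun j : 'I_m.+1 => t (Posz j - Posz m.+1))) /= sub0r.
  have L1 : \sum_(i < m.+1) t (Posz m.+1 - Posz (bump 0 i)) =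
      \sum_(i < m.+1) t (Posz m - Posz i).
    by apply: eq_bigr => i _; congr t; rewrite /bump /= !intS; ring.
  have L2 : \sum_(i < m) t (Posz (bump 0 i) - Posz m.+1) =
      \sum_(i < m) t (Posz i - Posz m).
    by apply: eq_bigr => i _; congr t; rewrite /bump /= !intS; ring.
  rewrite NegzE.
  rewrite L1 L2; ring.
elim: N => [|N IH]; first by rewrite !big_ord0.
rewrite [RHS]big_ord_recr /= -IH S big_ord_recr /=.
under eq_bigr do rewrite big_ord_recr /=.
rewrite big_split /=; ring.
Qed.

(* By [double_sum_symmetric], the double sums divided by N are Cesaro means of the
   symmetric partial sums. *)
Lemma sum_ge_of_fejer_means t (l c : R) :
  partial_sum t @ totally --> l ->
  (forall N, N.+1%:R * c <= \sum_(j < N.+1) \sum_(k < N.+1) t (Posz j - Posz k)) ->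
  c <= l.
Proof.
move=> tl H; pose S m := \sum_(n <- symmetric_range m) t n.
have Sl : S @ \oo --> l.
  have -> : S = partial_sum t \o symmetric_range by apply/funext => m; rewrite /= partial_sumE.
  exact: cvg_comp symmetric_range_cvg tl.
have := cesaro Sl => Al.
rewrite -(cvg_lim (@Rhausdorff R) Al); apply: limr_ge; first by apply/cvg_ex; exists l.
near=> n.
(* The mean of index n averages n + 1 terms, which matches [N.+1] in the hypothesis. *)
rewrite /arithmetic_mean /= mulrC ler_pdivlMr ?ltr0n // mulrC.
apply: (le_trans (H n)); rewrite double_sum_symmetric /series /=.
by rewrite big_mkord.
Unshelve. all: by end_near. Qed.

End integer_sums.

(** * The Fourier transform of the B-spline and the decay of its coefficients *)

Section bspline_hat.
Context {R : realType}.
Local Notation mu := (@lebesgue_measure R).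
Local Notation integrable f := (mu.-integrable [set: R] (EFin \o f)).
Implicit Types (sigma w h x t : R).

Lemma bspline_hatE sigma w : bspline_hat sigma w = `|sinc (w / 2)| `^ (sigma + 1).
Proof.
rewrite /bspline_hat /sinc mulf_eq0 invr_eq0 pnatr_eq0 orbF.
by case: eqVneq => // _; rewrite normr1 powR1.
Qed.

Lemma measurable_bspline_hat sigma : measurable_fun [set: R] (bspline_hat sigma).
Proof.
have -> : bspline_hat sigma =
    (powR (R:=R))^~ (sigma + 1) \o (Num.norm \o (sinc \o ( *%R^~ 2^-1))).
  by apply/funext => w; rewrite bspline_hatE.
apply: measurableT_comp; first exact: measurable_powR.
apply: measurableT_comp; first exact: normr_measurable.
apply: measurableT_comp; first exact: continuous_measurable_fun continuous_sinc.
by apply: measurable_funM.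
Qed.

Lemma bspline_hat_ge0 sigma w : 0 <= bspline_hat sigma w.
Proof. by rewrite bspline_hatE powR_ge0. Qed.

Lemma ler_div_half (C w : R) : 0 <= C -> C / (1 + (w / 2) ^+ 2) <= 4 * C / (1 + w ^+ 2).
Proof.
move=> C0; have w0 := sqr_ge0 w; have w1 := sqr_ge0 (w / 2).
rewrite ler_pdivrMr; last lra.
rewrite mulrAC ler_pdivlMr; last lra.
rewrite expr_div_n; nra.
Qed.

Lemma bspline_hat_decay sigma w : 1 <= sigma ->
  bspline_hat sigma w <= 16 / (1 + w ^+ 2).
Proof.
move=> s1; rewrite bspline_hatE (le_trans (powR_sinc_decay _ _)) //; first lra.
have := @ler_div_half 4 w (ler0n _ 4); lra.
Qed.

Lemma integrable_bspline_hat sigma : 1 <= sigma -> integrable (bspline_hat sigma).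
Proof.
move=> s1; apply: (@integrable_dominated _ _ 16) => [|w].
  exact: measurable_bspline_hat.
by rewrite ger0_norm ?bspline_hat_ge0 // bspline_hat_decay.
Qed.

Lemma bspline_hat_second_difference sigma : 1 <= sigma -> exists2 K : R, 0 <= K &
  forall h w,
    `|bspline_hat sigma (w + h) - 2 * bspline_hat sigma w + bspline_hat sigma (w - h)| <=
    K * h ^+ 2 / (1 + w ^+ 2).
Proof.
move=> s1; have [|C C0 HC] := @powR_sinc_second_difference R (sigma + 1); first lra.
(* The constant is unchanged: the factor 4 from rescaling the weight cancels against (h / 2)^2 = h^2
   / 4. *)
exists C => // h w; rewrite !bspline_hatE.
have -> : (w + h) / 2 = w / 2 + h / 2 by lra.
have -> : (w - h) / 2 = w / 2 - h / 2 by lra.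
rewrite (le_trans (HC _ _)) // (le_trans (ler_div_half _ _)) //.
  by rewrite mulr_ge0 ?sqr_ge0.
by rewrite expr_div_n; have -> : 4 * (C * (h ^+ 2 / 2 ^+ 2)) = C * h ^+ 2 by field.
Qed.

Lemma bspline_hat_lower_bound sigma w : 1 <= sigma -> `|w| <= pi ->
  (1 / 2) `^ (sigma + 1) <= bspline_hat sigma w.
Proof.
move=> s1 wpi; rewrite bspline_hatE.
have sincN x : sinc (- x) = sinc x.
  by rewrite /sinc oppr_eq0 sinN invrN mulrNN.
have sn x : sinc `|x| = sinc x by case: (ger0P x).
have H : 1 / 2 <= sinc (w / 2).
  rewrite -sn; apply: sinc_ge_half; rewrite normr_ge0 /= normrM (ger0_norm (_ : 0 <= 2^-1)) //.
  by rewrite ler_pM2r.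
rewrite ge0_ler_powR ?nnegrE ?normr_ge0 //; first lra.
by rewrite (le_trans H) // ler_norm.
Qed.

Lemma measurable_cosM t x : measurable_fun [set: R] (fun w => cos (t * (w - x))).
Proof.
have mc : measurable_fun [set: R] (@cos R).
  by apply: continuous_measurable_fun; exact: continuous_cos.
by apply: (measurableT_comp mc); apply: measurable_funM => //; apply: measurable_funB.
Qed.

Lemma measurable_cosMl t : measurable_fun [set: R] (fun w => cos (w * t)).
Proof.
have mc : measurable_fun [set: R] (@cos R).
  by apply: continuous_measurable_fun; exact: continuous_cos.
by apply: (measurableT_comp mc); apply: measurable_funM.
Qed.

Lemma measurable_sinMl t : measurable_fun [set: R] (fun w => sin (w * t)).
Proof.
have mc : measurable_fun [set: R] (@sin R).
  by apply: continuous_measurable_fun; exact: continuous_sin.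
apply: (measurableT_comp mc); by apply: measurable_funM.
Qed.

Definition bspline_re sigma t := (2 * pi)^-1 * \int[mu]_w (bspline_hat sigma w * cos (w * t)).
Definition bspline_im sigma t := (2 * pi)^-1 * \int[mu]_w (bspline_hat sigma w * sin (w * t)).

Lemma bsplineE sigma t :
  bspline sigma t = (bspline_re sigma t +i* bspline_im sigma t)%C.
Proof.
rewrite /bspline /Cintegral /expi /bspline_re /bspline_im.
have -> : \int[mu]_(w in setT)
      complex.Re ((bspline_hat sigma w)%:C%C * (cos (w * t) +i* sin (w * t))%C) =
    \int[mu]_w (bspline_hat sigma w * cos (w * t)).
  by apply: eq_Rintegral => w _ /=; rewrite mul0r subr0.
have -> : \int[mu]_(w in setT)
      complex.Im ((bspline_hat sigma w)%:C%C * (cos (w * t) +i* sin (w * t))%C) =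
    \int[mu]_w (bspline_hat sigma w * sin (w * t)).
  by apply: eq_Rintegral => w _ /=; rewrite mul0r addr0.
by apply/eqP; rewrite eq_complex /= !mul0r subr0 addr0 !eqxx.
Qed.

(** Both cos (w n) and sin (w n) change sign under the shift h = pi / n, so a single estimate covers
    both parts, and h^2 supplies the factor 1 / n^2. *)
Lemma bspline_decay sigma : 1 <= sigma -> exists2 K : R, 0 <= K &
  forall n : int, n != 0 ->
    `|bspline_re sigma n%:~R| <= K / n%:~R ^+ 2 /\ `|bspline_im sigma n%:~R| <= K / n%:~R ^+ 2.
Proof.
move=> s1; have [K K0 HK] := bspline_hat_second_difference s1.
pose I := \int[mu]_x (1 + x ^+ 2)^-1.
have I0 : 0 <= I by apply: Rintegral_ge0 => x _; rewrite invr_ge0 addr_ge0 ?sqr_ge0.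
have p0 : 0 < (2 * pi : R)^-1 by rewrite invr_gt0 mulr_gt0 ?pi_gt0.
exists ((2 * pi)^-1 * (K * pi ^+ 2 * I / 4)).
  by apply: mulr_ge0; [exact: ltW | nonneg].
move=> n n0; have nR : (n%:~R : R) != 0 by rewrite intr_eq0.
(* This shift is negative for negative n, which is harmless: the bound involves only h^2. *)
pose h : R := pi / n%:~R.
have E : K * h ^+ 2 * I / 4 = K * pi ^+ 2 * I / 4 / n%:~R ^+ 2 by rewrite /h; field.
have shift w : (w + h) * n%:~R = w * n%:~R + pi by rewrite /h; field.
have b (e : R -> R) : measurable_fun [set: R] e ->
    (forall x, `|e x| <= 1) -> alternating e h ->
  `|(2 * pi)^-1 * \int[mu]_w (bspline_hat sigma w * e w)| <=
     (2 * pi)^-1 * (K * pi ^+ 2 * I / 4) / n%:~R ^+ 2.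
  move=> me e1 ea; rewrite normrM (ger0_norm (ltW p0)) -mulrA ler_wpM2l ?(ltW p0) // -E.
  exact: Rintegral_antiperiodic (integrable_bspline_hat s1) (HK h) me e1 ea.
split; apply: b.
- exact: measurable_cosMl.
- by move=> x; exact: cos_max.
- by move=> x; rewrite shift cosDpi.
- exact: measurable_sinMl.
- by move=> x; exact: sin_max.
- by move=> x; rewrite shift sinDpi.
Qed.

End bspline_hat.

(** * The Fejer kernel *)

Section fejer.
Context {R : realType}.
Local Notation mu := (@lebesgue_measure R).
Local Notation integrable f := (mu.-integrable [set: R] (EFin \o f)).
Implicit Types (sigma w h x y t : R).

Lemma expi0 : expi (0 : R) = 1.
Proof. by rewrite /expi cos0 sin0. Qed.

Lemma expiD x y : expi (x + y) = expi x * expi y.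
Proof.
by apply/eqP; rewrite eq_complex /= cosD sinD [sin x * _ + _]addrC !eqxx.
Qed.

Lemma expiN x : expi (- x) = (expi x)^-1.
Proof.
have E : expi (- x) * expi x = 1 by rewrite -expiD addNr expi0.
have nz : expi x != 0 by apply/eqP => z; move/eqP: E; rewrite z mulr0 eq_sym oner_eq0.
by apply: (mulIf nz); rewrite E mulVf.
Qed.

Lemma expi_exprz x (n : int) : expi x ^ n = expi (n%:~R * x).
Proof.
have P (m : nat) : expi x ^+ m = expi (m%:R * x).
  elim: m => [|m IH]; first by rewrite mul0r expi0.
  by rewrite exprSr IH -expiD -natr1 mulrDl mul1r.
case: n => m; first by rewrite -exprnP P.
by rewrite NegzE -exprnN P mulrNz mulNr expiN.
Qed.

(** The angle is [acos] of the real part, with the sign of the imaginary part. The range [-pi, pi]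
    is the one where [bspline_hat_lower_bound] applies. *)
Lemma unit_circle_expi (z : R[i]) : `|z| = 1 -> exists2 x, `|x| <= pi & z = expi x.
Proof.
case: z => a b; rewrite normc_def => -[] /= ab.
have ab1 : a ^+ 2 + b ^+ 2 = 1.
  by rewrite -[LHS]sqr_sqrtr ?ab ?expr1n // addr_ge0 ?sqr_ge0.
have b2 := sqr_ge0 b.
have a1 : -1 <= a <= 1 by apply/andP; split; nra.
have aE : cos (acos a) = a by rewrite acosK // in_itv.
have bE : sin (acos a) = `|b|.
  by rewrite sin_acos // -sqrtr_sqr; congr Num.sqrt; lra.
have api : `|acos a| <= pi by rewrite ger0_norm ?acos_ge0 ?acos_lepi.
have [b0|b0] := leP 0 b.
  by exists (acos a) => //; rewrite /expi aE bE ger0_norm.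
by exists (- acos a); rewrite ?normrN // /expi cosN sinN aE bE ltr0_norm ?opprK.
Qed.

(** The factor exp(-i n x) merges with exp(i w n) under the integral, which turns the frequency w
    into w - x. *)
Lemma Re_G_term sigma x (n : int) : 1 <= sigma ->
  complex.Re (G_term sigma (expi x) n : R[i]) =
  (2 * pi)^-1 * \int[mu]_w (bspline_hat sigma w * cos (n%:~R * (w - x))).
Proof.
move=> s1; rewrite /G_term expi_exprz bsplineE /= mulrNz mulNr cosN sinN mulrN opprK.
rewrite /bspline_re /bspline_im -!mulrA -mulrDr; congr (_ * _).
have Fi := integrable_bspline_hat s1.
have Ic := integrableM_bounded Fi (measurable_cosMl n%:~R) (fun w => cos_max _).
have Is := integrableM_bounded Fi (measurable_sinMl n%:~R) (fun w => sin_max _).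
rewrite -!RintegralZr // -RintegralD //; first last.
- exact: (integrableZr measurableT _ Is).
- exact: (integrableZr measurableT _ Ic).
apply: eq_Rintegral => w _.
by rewrite mulrBr cosB (mulrC w); ring.
Qed.

Lemma G_term_decay sigma x : 1 <= sigma -> exists2 K : R, 0 <= K & forall n : int, n != 0 ->
  `|complex.Re (G_term sigma (expi x) n : R[i])| <= K / n%:~R ^+ 2 /\
  `|complex.Im (G_term sigma (expi x) n : R[i])| <= K / n%:~R ^+ 2.
Proof.
move=> s1; have [K K0 HK] := bspline_decay s1.
(* Rotation by exp(-i n x) mixes the real and imaginary parts, each bounded by K / n^2. *)
exists (2 * K); first by rewrite mulr_ge0.
move=> n n0; have [] := HK n n0.
rewrite /G_term expi_exprz bsplineE /=.
move: (bspline_re _ _) (bspline_im _ _) (_ * x) => p q y Hp Hq.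
have bound u v : `|u| <= K / n%:~R ^+ 2 -> `|v| <= K / n%:~R ^+ 2 ->
    forall e f : R, `|e| <= 1 -> `|f| <= 1 -> `|u * e + v * f| <= 2 * K / n%:~R ^+ 2.
  move=> Hu Hv e f e1 f1; rewrite (le_trans (ler_normD _ _)) // !normrM.
  have : `|u| * `|e| <= `|u| by rewrite ler_piMr.
  have : `|v| * `|f| <= `|v| by rewrite ler_piMr.
  lra.
split; first by rewrite -mulrN; apply: bound; rewrite ?normrN ?cos_max ?sin_max.
by rewrite [X in `|X|]addrC; apply: bound; rewrite ?cos_max ?sin_max.
Qed.

(** Integrability of the sum is carried along because additivity of the integral requires it in the
    induction. *)
Lemma Rintegral_sum (I : Type) (s : seq I) (f : I -> R -> R) :
  (forall i, integrable (f i)) ->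
  \sum_(i <- s) \int[mu]_w f i w = \int[mu]_w (\sum_(i <- s) f i w) /\
  integrable (fun w => \sum_(i <- s) f i w).
Proof.
move=> fi; elim: s => [|i s [IH1 IH2]].
  rewrite big_nil; under eq_Rintegral do rewrite big_nil.
  split; first by rewrite Rintegral_cst // mul0r.
  under eq_fun do rewrite big_nil; exact: integrable0.
split.
  rewrite big_cons IH1 -RintegralD //.
  by apply: eq_Rintegral => w _; rewrite big_cons.
have -> : (fun w => \sum_(j <- i :: s) f j w) = (fun w => f i w + \sum_(j <- s) f j w).
  by apply/funext => w; rewrite big_cons.
exact: (integrableD measurableT (fi i) IH2).
Qed.

(** The real form of |sum_j exp(i j y)|^2, that is, N times the Fejer kernel; the right-hand side
    shows that it is nonnegative. *)
Lemma dirichlet_sqr (N : nat) y :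
  \sum_(p : 'I_N * 'I_N) cos ((p.1%:R - p.2%:R) * y) =
  (\sum_(j < N) cos (j%:R * y)) ^+ 2 + (\sum_(j < N) sin (j%:R * y)) ^+ 2.
Proof.
rewrite !expr2 !big_distrlr /= -big_split /=.
rewrite -(pair_bigA _ (fun i j : 'I_N => cos ((i%:R - j%:R) * y))) /=.
apply: eq_bigr => i _; rewrite -big_split /=; apply: eq_bigr => j _.
by rewrite mulrBl cosB.
Qed.

(** The integrand is nonnegative, so the integral is at least its part over an interval of length
    1/N with endpoint x. There the kernel sum is at least (N/2)^2, and the product with the length
    is N/4. *)
Lemma fejer_lower_bound sigma x (M : nat) : 1 <= sigma -> `|x| <= pi ->
  M.+1%:R * ((2 * pi)^-1 * ((1 / 2) `^ (sigma + 1) / 4)) <=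
  \sum_(j < M.+1) \sum_(k < M.+1)
    complex.Re (G_term sigma (expi x) (Posz j - Posz k) : R[i]).
Proof.
move=> s1 xpi; set N := M.+1.
have N0 : 0 < N%:R :> R by rewrite ltr0n.
have Fi := integrable_bspline_hat s1.
pose f (p : 'I_N * 'I_N) w := bspline_hat sigma w * cos ((p.1%:R - p.2%:R) * (w - x)).
have fi p : integrable (f p).
  exact: integrableM_bounded Fi (measurable_cosM _ x) (fun w => cos_max _).
have [E1 E2] := Rintegral_sum (index_enum ('I_N * 'I_N)%type) fi.
have -> : \sum_(j < N) \sum_(k < N)
      complex.Re (G_term sigma (expi x) (Posz j - Posz k) : R[i]) =
    (2 * pi)^-1 * \int[mu]_w (\sum_p f p w).
  rewrite pair_bigA /= -E1 mulr_sumr; apply: eq_bigr => p _.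
  by rewrite Re_G_term // intrD mulrNz.
rewrite mulrCA ler_wpM2l ?invr_ge0 ?mulr_ge0 ?pi_ge0 //.
(* The interval extends to the left of x if x >= 0 and to the right otherwise; since 1/N <= 1, it
   stays in [-pi, pi] even when x is an endpoint. *)
pose a : R := if 0 <= x then x - N%:R^-1 else x.
pose A := `[a, a + N%:R^-1]%classic.
pose c : R := (1 / 2) `^ (sigma + 1) * (N%:R / 2) ^+ 2.
have c0 : 0 <= c by nonneg.
have Ai : integrable (fun w => c * \1_A w).
  exact: (integrableZl measurableT c (integrable_indic_itv a (a + N%:R^-1) true false)).
have Ni0 : 0 < N%:R^-1 :> R by rewrite invr_gt0.
have -> : N%:R * ((1 / 2) `^ (sigma + 1) / 4) = \int[mu]_w (c * \1_A w).
  rewrite RintegralZl //; last exact: integrable_indic_itv.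
  have -> : \int[mu]_w (\1_A w) = N%:R^-1.
    transitivity (fine (mu A)).
      rewrite /Rintegral (integral_indic _ measurableT); first by rewrite setIT.
      exact: measurable_itv.
    rewrite lebesgue_measure_itv /= lte_fin ltrDl Ni0 /=.
    by rewrite addrAC subrr add0r.
  by rewrite /c; field; rewrite gt_eqF.
apply: le_Rintegral => // w _.
rewrite /f -mulr_sumr dirichlet_sqr indicE.
have F0 := bspline_hat_ge0 sigma w.
case: (boolP (w \in A)) => [/set_mem|_]; last by rewrite mulr0; nonneg.
rewrite /A /= in_itv /= mulr1 => /andP[aw wa].
have N1 : N%:R^-1 <= 1 :> R by rewrite invf_le1 // ler1n.
have pi2 := pi_ge2 R.
have [wx wpi] : `|w - x| <= N%:R^-1 /\ `|w| <= pi.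
  move: aw wa xpi; rewrite /a !ler_norml.
  case: ifP => x0; last move/negbT: x0; rewrite -?ltNge => *.
    by split; apply/andP; split; lra.
  by split; apply/andP; split; lra.
apply: ler_pM; nonneg; first exact: bspline_hat_lower_bound.
(* The squared sine sum is dropped. On [A] the arguments j (w - x) are at most 1 in absolute value,
   so every cosine is at least 1 - 1/2. *)
rewrite -[leLHS]addr0; apply: lerD; last exact: sqr_ge0.
have S : N%:R / 2 <= \sum_(j < N) cos (j%:R * (w - x)).
  have -> : N%:R / 2 = \sum_(j < N) (1 / 2 : R).
    by rewrite sumr_const card_ord -[RHS]mulr_natl mul1r.
  apply: ler_sum => j _.
  have jN : `|j%:R * (w - x)| <= 1.
    rewrite normrM (ger0_norm (ler0n _ j)).
    have jn : j%:R <= N%:R :> R by rewrite ler_nat ltnW.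
    apply: (@le_trans _ _ (N%:R * N%:R^-1)); first exact: ler_pM.
    by rewrite divff // gt_eqF.
  have /andP[_] := onem_cos_le (j%:R * (w - x)).
  have : (j%:R * (w - x)) ^+ 2 <= 1 by rewrite -real_normK ?num_real // expr_le1.
  lra.
have N2 : 0 <= N%:R / 2 :> R by rewrite divr_ge0.
by rewrite ler_sqr ?nnegrE // (le_trans N2 S).
Qed.

End fejer.

(** * Convergence of the series and positivity of the real part of its sum *)

Local Open Scope complex_scope.

Theorem theorem2p1 (R : realType) (sigma : R) (hsigma : 1 <= sigma)
    (z : R[i]) (hz : `|z| = 1) :
  G_converges sigma z /\ G sigma z <> 0.
Proof.
have [x xpi ->] := unit_circle_expi hz.
have [K K0 HK] := G_term_decay x hsigma.
have /cvg_ex[p cp] :=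
  is_cvg_partial_sum_abs (partial_sum_square_decay K0 (fun n n0 => (HK n n0).1)).
have /cvg_ex[q cq] :=
  is_cvg_partial_sum_abs (partial_sum_square_decay K0 (fun n n0 => (HK n n0).2)).
have Gc := cvg_partial_sum_complex cp cq.
have p_gt0 : 0 < p.
  (* The lower bound for the means does not depend on N, so it passes to the limit and keeps the
     real part of the sum away from 0. *)
  apply: lt_le_trans (sum_ge_of_fejer_means cp (fun N => fejer_lower_bound N hsigma xpi)).
  by rewrite mulr_gt0 ?invr_gt0 ?divr_gt0 ?powR_gt0 ?mulr_gt0 ?pi_gt0.
split; first by apply/cvg_ex; exists (p +i* q)%C.
rewrite /G /sum (cvg_lim _ Gc); last exact: norm_hausdorff.
by case=> /eqP; rewrite gt_eqF.
Qed.
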